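(* Let $k\ge 2$ and $n$ be integers with $2k\le n\le k^2$. Then $$m(n,k,1)=k\binom{n-1}{k}.$$
   Context: For integers $n\ge k+1$, let $\mathcal V(n,k,1)\subset\mathbb R^n$ be the set of all vectors with coordinates in $\{0,1,-1\}$ having exactly $k$ coordinates equal to $+1$ and exactly one coordinate equal to $-1$ (all other coordinates $0$). For $n\ge 2k$ the minimum possible scalar product of two vectors in $\mathcal V(n,k,1)$ is $-2$. A family $\mathcal V\subset\mathcal V(n,k,1)$ is called intersecting if $\langle v,w\rangle>-2$ for all $v,w\in\mathcal V$. Let $m(n,k,1)$ be the maximum of $|\mathcal V|$ over all intersecting families $\mathcal V\subset\mathcal V(n,k,1)$. *)

(* Defs.v *)
From HB Require Import structures.
From mathcomp Require Import all_boot all_order all_algebra.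
From mathcomp Require Import finmap.
From mathcomp Require Import reals.

Set Implicit Arguments.
Unset Strict Implicit.
Unset Printing Implicit Defensive.

Import Order.TTheory GRing.Theory Num.Theory.
Local Open Scope fset_scope.
Local Open Scope ring_scope.

Definition dot (R : realType) (n : nat) (v w : 'rV[R]_n) : R :=
  \sum_(i < n) v 0 i * w 0 i.

Definition signs (R : realType) : seq R := [:: 0; 1; -1].

Definition is_vec1 (R : realType) (n k : nat) (v : 'rV[R]_n) : bool :=
  [&& [forall i, v 0 i \in signs R],
      #|[set i | v 0 i == 1]| == k
    & #|[set i | v 0 i == -1]| == 1%N].

(* {0, 1, -1}^n; [seq_sub (signs R)] is the finite subtype of R with elements
   0, 1, -1, so the matrices over it form a finite type. *)
Definition sign_vectors (R : realType) (n : nat) : {fset 'rV[R]_n} :=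
  [fset map_mx val x | x in 'rV[seq_sub (signs R)]_n].

(* V(n, k, 1) *)
Definition vec1 (R : realType) (n k : nat) : {fset 'rV[R]_n} :=
  [fset v in sign_vectors R n | is_vec1 k v].

Lemma mem_vec1 (R : realType) (n k : nat) (v : 'rV[R]_n) :
  (v \in vec1 R n k) = is_vec1 k v.
Proof.
rewrite !inE /=; apply: andb_idl => /and3P[/forallP v_sign _ _].
apply/imfsetP; exists (\row_i SeqSub (v_sign i)) => //.
by apply/rowP => i; rewrite !mxE.
Qed.

Definition intersecting (R : realType) (n : nat) (F : {fset 'rV[R]_n}) : bool :=
  [forall v : F, forall w : F, -2 < dot (val v) (val w)].

(* m(n, k, 1) *)
Definition max_intersecting (R : realType) (n k : nat) : nat :=
  \max_(F <- fpowerset (vec1 R n k) | intersecting F) #|` F|.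

(* Main.v *)
(* A vector is encoded by the pair (A, a) of its set A of k coordinates +1 and
   its coordinate a equal to -1; (A, a) and (B, b) have scalar product -2 iff A
   and B are disjoint, a lies in B and b lies in A.  The vectors with a fixed
   coordinate equal to +1 attain the bound.

   The upper bound is by induction on n, starting from n = 2k, where complementary
   sets A and ~A cannot both occur.  Write N = n - 1.  After shifting (exchanging
   coordinates so that large entries move left), let G be the family of the k-sets
   A such that (A, n) is in the family, and K the set of the pairs (U, e) with e in U
   such that (U - e + n, e) is in the family.  Shiftedness gives
   - U is in G whenever (U, e) is in K, and no A in G meets U exactly in e;
   - the sets U occurring in K are pairwise intersecting.
   Katona's circle method on the N - 1 points other than e, with arcs of length
   k - 1, and on all N points, with arcs of length k marked at their last point,
   gives respectively
     (k - 1) k |G| + (N - k) |K| <= (k - 1) k C(N, k)  and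
     N |K| <= (k - 1) k C(N, k).
   For N <= k^2 these combine to |G| + |K| <= k C(N - 1, k - 1), which is exactly the
   increment of k C(n - 1, k). *)
Require Import Defs.
From mathcomp Require Import all_boot all_order all_algebra all_fingroup.
From mathcomp Require Import finmap.
From mathcomp Require Import reals.
From mathcomp Require Import zify ring lra.

Set Implicit Arguments.
Unset Strict Implicit.
Unset Printing Implicit Defensive.

(** * The circle method *)

Lemma sum_periodic (M s : nat) (f : nat -> nat) :
  (forall i, f (i + M) = f i) -> \sum_(i < M) f (s + i) = \sum_(i < M) f i.
Proof.
move=> fM; elim: s => [|s IHs] //; rewrite -IHs.
case: M fM {IHs} => [|M] fM; first by rewrite !big_ord0.
rewrite big_ord_recr [RHS]big_ord_recl /= addn0 addnC; congr (_ + _)%N.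
  by rewrite addSnnS fM.
by apply: eq_bigr => i _; rewrite /bump /= add1n addnS addSn.
Qed.

(* For x = z this bounds an intersecting family of arcs of length r by r.  If z i
   holds, then x lives on the indices i - r < j < i + r, and the arcs starting at j and
   at j - r are disjoint, which gives #x + #z <= 2r. *)
Lemma circle_bound (M r : nat) (x z : nat -> bool) :
    2 * r <= M ->
    (forall i, x (i + M) = x i) -> (forall i, z (i + M) = z i) ->
    (forall i, z i -> x i) ->
    (forall i d, r <= d <= M - r -> z i -> ~~ x (i + d)) ->
  r * (\sum_(i < M) x i) + (M - r) * (\sum_(i < M) z i) <= r * M.
Proof.
move=> le2rM xM zM zx zNx.
have x_le : \sum_(i < M) x i <= M.
  apply: (@leq_trans (\sum_(i < M) 1)); last by rewrite sum1_card card_ord.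
  by apply: leq_sum => i _; case: (x i).
have [/existsP[s0 zs]|z0] := boolP [exists i : 'I_M, z i]; last first.
  rewrite [X in (M - r) * X]big1 => [|i _]; first by rewrite muln0 addn0 leq_mul2l x_le orbT.
  by apply/eqP; rewrite eqb0; apply: contra z0 => zi; apply/existsP; exists i.
pose s : nat := s0; have {}zs : z s by [].
have Nr0 : 0 < r.
  case: r {le2rM} zNx => // zNx; have := zNx s 0 isT zs.
  by rewrite addn0 zx.
have xz_excl i d : r <= d <= M - r -> x i -> ~~ z (i + d).
  move=> /andP[rd dM] xi; apply/negP => /zNx - /(_ (M - d)).
  have -> : r <= M - d <= M - r by lia.
  have -> : i + d + (M - d) = i + M by lia.
  by rewrite xM xi => /(_ isT).
(* Rotate [s] to the origin. The indices from [r] to [M - r] contribute nothing and the index 0 at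
   most 2. Each [j] with [0 < j < r] is paired with [j + (M - r)], which is [j - r] modulo [M]; a
   pair contributes at most 2. *)
have key : \sum_(i < M) (x i + z i) <= 2 * r.
  rewrite -(@sum_periodic M s (fun i => x i + z i)); last by move=> i; rewrite xM zM.
  pose f i := x (s + i) + z (s + i).
  rewrite -[X in X <= _]/(\sum_(i < M) f i).
  rewrite -(big_mkord xpredT f).
  rewrite (@big_cat_nat _ _ _ r) //=; last by lia.
  rewrite (@big_cat_nat _ _ _ (M - r).+1 r) /=; [|lia|lia].
  rewrite [X in _ + (X + _)]big_nat_cond [X in _ + (X + _)]big1 => [|i]; last first.
    rewrite andbT => ri; have /(zNx s)/(_ zs) nx : r <= i <= M - r by lia.
    rewrite /f (negbTE nx) /=; case E: (z _) => //.
    by rewrite (zx _ E) in nx.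
  rewrite add0n (@big_ltn _ _ _ 0) //.
  have -> : \sum_((M - r).+1 <= i < M) f i = \sum_(1 <= i < r) f (i + (M - r)).
    by rewrite -[(M - r).+1]add1n big_addn; congr bigop; rewrite subKn //; lia.
  rewrite -addnA -big_split /=.
  have -> : 2 * r = 2 + \sum_(1 <= i < r) 2 by rewrite sum_nat_const_nat; lia.
  apply: leq_add; first by rewrite /f; case: (x _); case: (z _).
  rewrite big_nat_cond [X in _ <= X]big_nat_cond.
  apply: leq_sum => j /andP[/andP[j1 jr] _]; rewrite /f !addnA.
  have d_ok : r <= M - r <= M - r by lia.
  have := zNx (s + j) (M - r) d_ok; have := xz_excl (s + j) (M - r) d_ok.
  case: (x (s + j)); case: (z (s + j)); case: (x _); case: (z _) => //=;
    by [move=> /(_ isT) | move=> _ /(_ isT)].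
have zx_sum : \sum_(i < M) z i <= \sum_(i < M) x i.
  by apply: leq_sum => i _; case E: (z i) => //; rewrite zx.
move: key zx_sum; rewrite big_split /=.
set a := \sum_(i < M) x i; set b := \sum_(i < M) z i => ab2r ba.
(* From [b <= a] and [a + b <= 2 * r] follows [b <= r]; the left side is
   [r * (a + b) + (M - 2 * r) * b]. *)
have [m ->] : exists m, M = 2 * r + m by exists (M - 2 * r); lia.
have : r * (a + b) + m * b <= r * (2 * r) + m * r by rewrite leq_add // leq_mul2l; lia.
by rewrite (_ : 2 * r + m - r = r + m); lia.
Qed.

(** * Double counting over permutations of marked sets *)

Lemma perm_of_seqs (T : finType) (s t : seq T) :
  uniq s -> uniq t -> size s = size t -> (forall x, x \in s) ->
  exists p : {perm T}, forall i x0 y0, i < size s -> p (nth x0 s i) = nth y0 t i.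
Proof.
move=> us ut st sT.
pose f x := nth x t (index x s).
have f_inj : injective f.
  move=> x y; rewrite /f (set_nth_default x y) -?st ?index_mem // => /eqP.
  rewrite nth_uniq -?st ?index_mem // => /eqP xy.
  by rewrite -(nth_index x (sT x)) xy nth_index.
exists (perm f_inj) => i x0 y0 lt_is; rewrite permE /f index_uniq //.
by apply: set_nth_default; rewrite -st.
Qed.

(** List the whole type with the mark first, then the rest of the set, then its complement; the
    permutation matches two such lists position by position. *)
Lemma marked_transitive (T : finType) (A B : {set T}) (a b : T) :
    #|A| = #|B| -> a \in A -> b \in B ->
  exists p : {perm T}, p @: A = B /\ p a = b.
Proof.
move=> AB aA bB.
pose enum_at (C : {set T}) c := c :: enum (C :\ c) ++ enum (~: C).
have enumP (C : {set T}) (c : T) : c \in C ->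
    [/\ uniq (enum_at C c), size (enum_at C c) = #|T| & forall x, x \in enum_at C c].
  move=> cC; split.
  - rewrite /= cat_uniq !enum_uniq mem_cat !mem_enum !inE eqxx cC /= andbT.
    by apply/hasPn => x; rewrite !mem_enum !inE => /negbTE->; rewrite andbF.
  - rewrite /= size_cat -!cardE -addSn -(cardsC C); congr (_ + _)%N.
    by rewrite (cardsD1 c C) cC.
  - move=> x; rewrite inE mem_cat !mem_enum !inE.
    by case: eqP => //= _; case: (x \in C).
have [uA sA mA] := enumP A a aA; have [uB sB mB] := enumP B b bB.
have [p pE] := perm_of_seqs uA uB (etrans sA (esym sB)) mA.
have pa : p a = b by exact: (pE 0 a b).
exists p; split=> //; apply/eqP; rewrite eqEcard card_imset; last exact: perm_inj.
rewrite AB leqnn andbT.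
apply/subsetP => _ /imsetP[x xA ->].
have xs : x \in a :: enum (A :\ a) by rewrite inE mem_enum !inE xA andbT orbN.
have szAB : size (a :: enum (A :\ a)) = size (b :: enum (B :\ b)).
  rewrite /= -!cardE; move: (cardsD1 a A) (cardsD1 b B); rewrite aA bB AB.
  by move=> -> /eqP; rewrite eqn_add2l => /eqP ->.
have := pE (index x (a :: enum (A :\ a))) a b.
rewrite /enum_at -!cat_cons size_cat ltn_addr ?index_mem // => /(_ isT).
rewrite !nth_cat -szAB index_mem xs nth_index // => ->.
have := mem_nth b (_ : index x (a :: enum (A :\ a)) < size (b :: enum (B :\ b))).
rewrite -szAB index_mem => /(_ xs); rewrite inE mem_enum !inE.
by case/orP => [/eqP->|/andP[]].
Qed.

Lemma card_marked (T : finType) k :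
  #|[set p : {set T} * T | (#|p.1| == k) && (p.2 \in p.1)]| = k * 'C(#|T|, k).
Proof.
rewrite -sum1dep_card.
rewrite (eq_bigl (fun p : {set T} * T => (#|p.1| == k) && (p.2 \in p.1))) //.
rewrite -(pair_big_dep (fun A : {set T} => #|A| == k) (fun A a => a \in A) (fun _ _ => 1)) /=.
rewrite (eq_bigr (fun=> k)) => [|A /eqP Ak]; last by rewrite sum1_card.
rewrite sum_nat_const mulnC; congr (_ * _).
by rewrite -(card_draws T k) cardsE.
Qed.

(* All marked k-sets (U, u) are equally likely images of (I, i) under a random
   permutation. *)
Lemma marked_average (T : finType) (k : nat) (K : {set {set T} * T}) (I : {set T}) (i : T) :
    #|I| = k -> i \in I ->
    (forall p, p \in K -> #|p.1| = k /\ p.2 \in p.1) ->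
  k * 'C(#|T|, k) * #|[set s : {perm T} | (s @: I, s i) \in K]| = (#|T|)`! * #|K|.
Proof.
move=> Ik iI KP.
pose m (s : {perm T}) := (s @: I, s i).
pose q := #|[set s | m s == (I, i)]|.
(* Right multiplication by a permutation carrying [(I, i)] to [(U, u)] is a bijection between the
   fibres of [m]. *)
have fiber (p : {set T} * T) : #|p.1| = k -> p.2 \in p.1 -> #|[set s | m s == p]| = q.
  case: p => U u /= Uk uU.
  have [t [tI ti]] := marked_transitive (etrans Ik (esym Uk)) iI uU.
  rewrite /q -[RHS](card_imset _ (mulIg t)); apply: eq_card => s.
  rewrite [LHS]inE; apply/eqP/imsetP => [ms|[s' + ->]]; last first.
    rewrite inE => /eqP[sI si]; rewrite /m permM si ti -tI -[in RHS]sI -imset_comp.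
    by congr pair; apply: eq_imset => x /=; rewrite permM.
    exists (s * t^-1)%g; last by rewrite mulgKV.
    rewrite inE; case: ms => sI si; rewrite /m permM si -ti permK.
    rewrite xpair_eqE eqxx andbT -[X in _ == X](@imset_id _ I).
    have -> : (s * t^-1)%g @: I = t^-1%g @: (s @: I).
      by rewrite -imset_comp; apply: eq_imset => x; rewrite /= permM.
    rewrite sI -tI -imset_comp; apply/eqP/eq_imset => x /=; exact: permK.
have sum_fibers (L : {set {set T} * T}) : (forall p, p \in L -> #|p.1| = k /\ p.2 \in p.1) ->
    #|[set s | m s \in L]| = q * #|L|.
  move=> LP; rewrite -sum1dep_card (partition_big m (mem L)) //=.
  rewrite (eq_bigr (fun=> q)) ?sum_nat_const 1?mulnC // => p pL.
  have [p1 p2] := LP p pL; rewrite -(fiber p p1 p2) -sum1dep_card.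
  by apply: eq_bigl => s; case: eqP => [->|]; rewrite ?pL ?andbF.
(* Counting the preimage of all marked [k]-sets determines [q]. *)
have full : (#|T|)`! = q * (k * 'C(#|T|, k)).
  rewrite -card_marked -sum_fibers => [|p]; last by rewrite inE => /andP[/eqP].
  rewrite -cardsT -card_perm; apply: eq_card => s; rewrite !inE /=.
  rewrite mem_imset ?iI; last exact: perm_inj.
  rewrite (card_imset _ (@perm_inj _ s)) Ik eqxx.
  by apply/subsetP => x _; rewrite inE.
by rewrite sum_fibers // full; lia.
Qed.

(** * Arcs of points on a circle *)

Definition arc (T : finType) (c : nat -> T) (i r : nat) : {set T} :=
  [set c (i + t) | t : 'I_r].

(** The circle is unrolled: its points are indexed by all naturals with period [M], so arcs need no
    wrapping. The sequence may miss points of [T], which allows a circle through all points but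
    one. *)
Definition circular (T : finType) (M : nat) (c : nat -> T) : Prop :=
  forall a b, c a = c b <-> a = b %[mod M].

Section Arcs.
Variables (T : finType) (M : nat) (c : nat -> T).
Hypothesis cP : circular M c.

Lemma circular_shift_inj i a b : a < M -> b < M -> c (i + a) = c (i + b) -> a = b.
Proof.
by move=> aM bM /cP/eqP; rewrite eqn_modDl !modn_small // => /eqP.
Qed.

Lemma circular_period i : c (i + M) = c i.
Proof. by apply/cP; rewrite modnDr. Qed.

Lemma arc_period i r : arc c (i + M) r = arc c i r.
Proof. by apply: eq_imset => t; rewrite addnAC circular_period. Qed.

Lemma card_arc i r : r <= M -> #|arc c i r| = r.
Proof.
move=> rM; rewrite card_imset ?card_ord // => t u /circular_shift_inj tu.
by apply/val_inj/tu; apply: leq_trans (ltn_ord _) rM.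
Qed.

Lemma mem_arc i t r : t < r -> c (i + t) \in arc c i r.
Proof. by move=> tr; apply/imsetP; exists (Ordinal tr). Qed.

Lemma arc_disjoint i d r : r <= d <= M - r -> arc c i r :&: arc c (i + d) r = set0.
Proof.
move=> /andP[rd dM]; apply/eqP; rewrite setI_eq0; apply/pred0P => y /=.
apply/negP => /andP[/imsetP[t _ ->] /imsetP[u _]].
have := ltn_ord t; have := ltn_ord u; move: (val t) (val u) => {}t {}u ur tr.
by rewrite -addnA => /circular_shift_inj; lia.
Qed.

(** The strict bound keeps the far end of the second arc, at distance [2 * r], from coming round to
    the start of the first. *)
Lemma arc_meet i r : 2 * r < M ->
  arc c i r.+1 :&: arc c (i + r) r.+1 = [set c (i + r)].
Proof.
move=> rM; apply/setP => y; rewrite !inE; apply/andP/eqP => [[]|->]; last first.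
  by split; [exact: mem_arc | rewrite -{1}[i + r]addn0 mem_arc].
move=> /imsetP[t _ ->] /imsetP[u _].
have := ltn_ord t; have := ltn_ord u; move: (val t) (val u) => {}t {}u ur tr.
by rewrite -addnA => /circular_shift_inj tu; congr (c (_ + _)); lia.
Qed.

Lemma circular_perm (s : {perm T}) : circular M (s \o c).
Proof. by move=> a b; rewrite -cP; split=> [/perm_inj|/= ->]. Qed.

End Arcs.

Lemma arc_perm (T : finType) (c : nat -> T) (s : {perm T}) i r :
  arc (s \o c) i r = s @: arc c i r.
Proof. by rewrite -imset_comp. Qed.

(** By [marked_average] every position [j] contributes the same amount. *)
Lemma arcs_average (T : finType) (k M : nat) (K : {set {set T} * T})
    (I : nat -> {set T}) (i : nat -> T) :
    (forall j, #|I j| = k) -> (forall j, i j \in I j) ->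
    (forall p, p \in K -> #|p.1| = k /\ p.2 \in p.1) ->
  k * 'C(#|T|, k) * (\sum_(s : {perm T}) \sum_(j < M) ((s @: I j, s (i j)) \in K))
    = M * ((#|T|)`! * #|K|).
Proof.
move=> Ik iI KP; rewrite exchange_big big_distrr /=.
rewrite (eq_bigr (fun=> (#|T|)`! * #|K|)) ?sum_nat_const ?card_ord // => j _.
rewrite -(marked_average (Ik j) (iI j) KP) -sum1dep_card [in RHS]big_mkcond /=.
by congr (_ * _); apply: eq_bigr => s _; case: (_ \in K).
Qed.

(** * The two circle inequalities and their combination *)

Section Counting.
Variables (k n : nat) (G : {set {set 'I_n.+1}}) (K : {set {set 'I_n.+1} * 'I_n.+1}).
Local Notation N := n.+1.
Local Notation C := 'C(N, k).
Hypothesis k2 : 2 <= k.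
Hypothesis kN : 2 * k <= N.
Hypothesis Gk : forall A, A \in G -> #|A| = k.
Hypothesis KG : forall p, p \in K -> p.1 \in G.
Hypothesis Kmark : forall p, p \in K -> p.2 \in p.1.
Hypothesis cross : forall p A, p \in K -> A \in G -> p.1 :&: A != [set p.2].
Hypothesis Kint : forall p q, p \in K -> q \in K -> p.1 :&: q.1 != set0.

Let KP p : p \in K -> #|p.1| = k /\ p.2 \in p.1.
Proof. by move=> pK; rewrite Gk ?KG // Kmark. Qed.

Lemma card_perm_ord : #|{perm 'I_N}| = N`!.
Proof.
rewrite -[in RHS](card_ord N) -[in RHS]cardsT -card_perm; apply: eq_card => s.
by rewrite !inE; apply/esym/subsetP => x _; rewrite inE.
Qed.

(** The mark stays off the circle formed by the other [n] points; the sets are the mark together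
    with an arc of length [k - 1]. Disjoint arcs give sets meeting exactly in the mark, which
    [cross] forbids for a member of [K] and one of [G]. *)
Lemma circle_cross_bound :
  (k - 1) * (k * #|G|) + (N - k) * #|K| <= (k - 1) * (k * C).
Proof.
pose r := k - 1; pose c j : 'I_N := inord (j %% n).+1.
have n0 : 0 < n by lia.
have kr : k = r.+1 by rewrite /r; lia.
have cP : circular n c.
  move=> a b; split=> [/(congr1 val)|ab]; last by rewrite /c ab.
  by rewrite /c /= !inordK ?ltnS ?ltn_pmod // => -[].
have c0 j : c j != ord0 by rewrite -val_eqE /c /= inordK // ltnS ltn_pmod.
(* Marking each member of [G] at all of its points lets [G] be averaged like [K], at the price of a
   factor [k]. *)
pose G' := [set p : {set 'I_N} * 'I_N | (p.1 \in G) && (p.2 \in p.1)].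
have G'P p : p \in G' -> #|p.1| = k /\ p.2 \in p.1.
  by rewrite inE => /andP[/Gk].
have cardG' : #|G'| = k * #|G|.
  rewrite -sum1dep_card.
  rewrite -(pair_big_dep (mem G) (fun A a => a \in A) (fun _ _ => 1)) /=.
  rewrite (eq_bigr (fun=> k)) => [|A /Gk Ak]; last by rewrite sum1_card.
  by rewrite sum_nat_const mulnC.
pose I j := ord0 |: arc c j r.
have I0 (d : nat -> 'I_N) (o : 'I_N) (j : nat) : (forall a, d a != o) -> o \notin arc d j r.
  by move=> dj; apply/imsetP => -[t _ /eqP]; rewrite eq_sym; apply/negP.
have Ik j : #|I j| = k by rewrite cardsU1 (I0 c ord0 j c0) (card_arc cP); lia.
have I_ord0 j : ord0 \in I j by rewrite setU11.
have bound (s : {perm 'I_N}) : r * (\sum_(j < n) ((s @: I j, s ord0) \in G'))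
    + (n - r) * (\sum_(j < n) ((s @: I j, s ord0) \in K)) <= r * n.
  have sP := circular_perm cP s.
  have sI j : s @: I j = s ord0 |: arc (s \o c) j r.
    by rewrite imsetU1 arc_perm.
  have sc0 a : (s \o c) a != s ord0 by rewrite /= (inj_eq perm_inj).
  have KG' (p : {set 'I_N} * 'I_N) : p \in K -> p \in G'.
    by move=> pK; rewrite inE KG // Kmark.
  apply: (@circle_bound n r (fun j => (s @: I j, s ord0) \in G')
                            (fun j => (s @: I j, s ord0) \in K)) => [|j|j|j|j d dr].
  - by lia.
  - by rewrite !sI (arc_period sP).
  - by rewrite !sI (arc_period sP).
  - exact: KG'.
  - move=> pK; rewrite inE /= negb_and; apply/orP; left.
    apply/negP => /(cross pK)/negP; apply => /=.
    by rewrite !sI -setUIr (arc_disjoint sP) // setU0.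
have := @leq_sum _ (index_enum {perm 'I_N}) xpredT _ _ (fun s _ => bound s).
rewrite sum_nat_const card_perm_ord big_split /= -!big_distrr /=.
have := arcs_average n Ik I_ord0 G'P; have := arcs_average n Ik I_ord0 KP.
rewrite card_ord cardG'.
set X := \sum_s _; set Y := \sum_s _ => EK EG le.
have F0 := fact_gt0 N.
(* The factor [k * C] lets both averages be substituted; the factor [n] times the factorial of [N]
   then cancels. *)
have : k * C * (r * Y + (n - r) * X) <= k * C * (N`! * (r * n)) by rewrite leq_mul2l le orbT.
rewrite -/r (_ : N - k = n - r); last by lia.
have -> : k * C * (r * Y + (n - r) * X) = (n * N`!) * (r * (k * #|G|) + (n - r) * #|K|).
  rewrite mulnDr (mulnCA _ r) (mulnCA _ (n - r)) EK EG.
  by move: N`! (n - r) #|G| #|K| => f m g h; lia.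
have -> : k * C * (N`! * (r * n)) = (n * N`!) * (r * (k * C)).
  by move: N`! C => f m; lia.
by rewrite leq_pmul2l // muln_gt0 n0.
Qed.

(** For [x = z] and [r = k - 1] the coefficients in [circle_bound] add up to [N], so one circle
    carries at most [k - 1] marked arcs from [K]; then average over permutations. *)
Lemma circle_marked_bound : N * #|K| <= (k - 1) * (k * C).
Proof.
pose r := k - 1; pose c j : 'I_N := inord (j %% N).
have kr : k = r.+1 by rewrite /r; lia.
have cP : circular N c.
  move=> a b; split=> [/(congr1 val)|ab]; last by rewrite /c ab.
  by rewrite /c /= !inordK ?ltn_pmod.
pose I j := arc c j k; pose i j := c (j + r).
have Ik j : #|I j| = k by rewrite (card_arc cP) //; lia.
have iI j : i j \in I j by apply: mem_arc; rewrite kr.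
have bound (s : {perm 'I_N}) : \sum_(j < N) ((s @: I j, s (i j)) \in K) <= r.
  have sP := circular_perm cP s.
  have sI j : s @: I j = arc (s \o c) j k by rewrite arc_perm.
  pose z j := (s @: I j, s (i j)) \in K.
  have zN j : z (j + N) = z j.
    by rewrite /z !sI (arc_period sP) /i addnAC (circular_period cP).
  (* The arcs starting at j and j + k - 1 meet exactly in the marked point of the
     former, so the marked arcs behave like intersecting arcs of length k - 1. *)
  have next j : z j -> ~~ z (j + r).
    move=> zj; apply/negP => /KG /= /(cross zj)/negP; apply.
    by rewrite /= !sI kr (arc_meet sP) //; lia.
  have := @circle_bound N r z z; rewrite -mulnDl => /(_ _ zN zN)/=.
  have -> : r + (N - r) = N by lia.
  rewrite (mulnC r N) leq_pmul2l //; apply=> // [|j d dr zj]; first by lia.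
  (* For [d = N - r] a further step of [r] leads back to [j]. Strictly between [r] and [N - r] one
     has [k <= d <= N - k], so the arcs are disjoint, against [Kint]. *)
  have [->|dr'] := eqVneq d r; first exact: next.
  have [dE|dr''] := eqVneq d (N - r).
    apply/negP => /next; rewrite dE -addnA subnK ?zN ?zj //; lia.
  apply/negP => zd; have /negP := Kint zj zd; apply => /=.
  by rewrite !sI (arc_disjoint sP) //; lia.
have := @leq_sum _ (index_enum {perm 'I_N}) xpredT _ _ (fun s _ => bound s).
rewrite sum_nat_const card_perm_ord => le.
have := arcs_average N Ik iI KP; rewrite card_ord => EK.
have : k * C * (\sum_(s : {perm 'I_N}) \sum_(j < N) ((s @: I j, s (i j)) \in K))
    <= k * C * (N`! * r).
  by rewrite leq_mul2l le orbT.
rewrite EK mulnCA [X in _ <= X](_ : _ = N`! * (r * (k * C))); last by lia.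
by rewrite leq_pmul2l // fact_gt0.
Qed.

Lemma counting_bound : N <= k ^ 2 -> #|G| + #|K| <= k * 'C(n, k - 1).
Proof.
move=> Nk2; have h1 := circle_cross_bound; have h2 := circle_marked_bound.
have EC : k * C = N * 'C(n, k - 1).
  by rewrite -[in LHS](subnK (ltnW k2)) addn1 -mul_bin_diag.
rewrite EC in h1 h2.
set r := k - 1 in h1 h2 *; set E := 'C(n, r) in h1 h2 *.
have h2' : #|K| <= r * E by rewrite -(leq_pmul2l (ltn0Sn n)); lia.
(* The weight [k ^ 2 - N] completes the coefficient [N - k] of [#|K|] to [r * k], matching that of
   [#|G|]; the right sides then add up to [r * k ^ 2 * E]. *)
have : (k ^ 2 - N) * #|K| <= (k ^ 2 - N) * (r * E) by rewrite leq_mul2l h2' orbT.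
move=> h3; have r0 : 0 < r by rewrite /r; lia.
have k0 : 0 < k by lia.
rewrite -(leq_pmul2l k0) -(leq_pmul2l r0).
have kr : k = r + 1 by rewrite /r; lia.
have -> : r * (k * (#|G| + #|K|)) = r * (k * #|G|) + (N - k) * #|K| + (k ^ 2 - N) * #|K|.
  rewrite mulnDr mulnDr -addnA -mulnDl; congr (_ + _).
  by rewrite mulnA (_ : N - k + (k ^ 2 - N) = r * k) //; move: Nk2; rewrite kr; nia.
apply: leq_trans (leq_add h1 h3) _.
rewrite mulnCA -mulnDl; move: Nk2; rewrite -mulnn; nia.
Qed.

End Counting.

(** * Shifting *)

Definition signed (T : finType) (k : nat) (p : {set T} * T) : bool :=
  (#|p.1| == k) && (p.2 \notin p.1).

Definition conflict (T : finType) (p q : {set T} * T) : bool :=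
  [&& [disjoint p.1 & q.1], p.2 \in q.1 & q.2 \in p.1].

Definition signed_intersecting (T : finType) (k : nat) (F : {set {set T} * T}) : Prop :=
  (forall p, p \in F -> signed k p) /\
  (forall p q, p \in F -> q \in F -> ~~ conflict p q).

Section Swap.
Variable T : finType.
Implicit Types (p q : {set T} * T) (i j x : T) (A : {set T}) (F : {set {set T} * T}).

(* The entry of the vector p at x, plus 1. *)
Definition coord p x : nat := if x == p.2 then 0 else (x \in p.1).+1.

Definition swap i j p := (tperm i j @: p.1, tperm i j p.2).

Lemma mem_tperm_imset i j A x : (x \in tperm i j @: A) = (tperm i j x \in A).
Proof.
by rewrite -{1}(tpermK i j x) mem_imset //; exact: perm_inj.
Qed.

Lemma swapK i j : involutive (swap i j).
Proof.
case=> A a; rewrite /swap /= tpermK; congr pair.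
by apply/setP => x; rewrite !mem_tperm_imset tpermK.
Qed.

Lemma coord_swap i j p x : coord (swap i j p) x = coord p (tperm i j x).
Proof. by rewrite /coord /= mem_tperm_imset (can2_eq (tpermK i j) (tpermK i j)). Qed.

Lemma signed_swap k i j p : signed k (swap i j p) = signed k p.
Proof.
by rewrite /signed /= mem_tperm_imset tpermK card_imset //; exact: perm_inj.
Qed.

Lemma conflict_sym p q : conflict p q = conflict q p.
Proof. by rewrite /conflict disjoint_sym; congr (_ && _); rewrite andbC. Qed.

Lemma conflict_swap i j p q : conflict (swap i j p) (swap i j q) = conflict p q.
Proof.
rewrite /conflict /= !mem_tperm_imset !tpermK; congr (_ && _).
by rewrite -!setI_eq0 -imsetI ?imset_eq0 // => x y _ _; exact: perm_inj.
Qed.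

Lemma swap_id i j p :
  i != p.2 -> j != p.2 -> (i \in p.1) = (j \in p.1) -> swap i j p = p.
Proof.
case: p => A a /= ia ja ijA; rewrite /swap /= tpermD //; congr pair.
by apply/setP => x; rewrite mem_tperm_imset; case: tpermP => [->|->|].
Qed.

(* Moving the larger entry of [p] onto the larger entry of [q] cannot decrease
   the scalar product. *)
Lemma conflict_swapl i j p q : i != j -> q.2 \notin q.1 ->
  coord p i < coord p j -> coord q j <= coord q i ->
  conflict (swap i j p) q -> conflict p q.
Proof.
move=> ij qq; rewrite -[coord p j](congr1 (coord p) (tpermL i j)).
rewrite -[coord p i](congr1 (coord p) (tpermR i j)) -!coord_swap.
move: (swap i j p) (swapK i j p) => p' <- lt_p le_q pq.
suff <- : swap i j q = q by rewrite conflict_swap.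
have /and3P[dis pq1 qp1] := pq.
have disP x : x \in p'.1 -> x \in q.1 -> false.
  by move=> xp xq; have := disjointFr dis xp; rewrite xq.
(* A conflict makes [q] equal to +1 where [p'] is -1, makes it at most 0 where [p'] is +1, and puts
   its -1 at one of the latter places. Since [p'] is larger at [i] than at [j] and [q] is not
   smaller there, the entries of [q] at [i] and [j] agree. *)
have [ib jb ijB] : [/\ i != q.2, j != q.2 & (i \in q.1) = (j \in q.1)].
  move: lt_p le_q; rewrite /coord.
  have [->|ip] := eqVneq i p'.2; first by rewrite ltn0.
  have [-> _|jp] := eqVneq j p'.2.
    have -> : (p'.2 == q.2) = false by apply: contraNF qq => /eqP <-.
    by rewrite pq1; case: (i == q.2) => //; case: (i \in q.1).
  case ip1: (i \in p'.1); case jp1: (j \in p'.1) => // _.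
  have -> : (j == q.2) = false by apply: contraFF jp1 => /eqP ->.
  by rewrite (disjointFr dis ip1); case: (i == q.2) => //; case: (j \in q.1).
exact: swap_id.
Qed.

(** A vector stays in place when its image is already present, so that shifting preserves the size
    of the family. *)
Definition shift i j F p :=
  if (coord p i < coord p j) && (swap i j p \notin F) then swap i j p else p.

Lemma shift_inj i j F : {in F &, injective (shift i j F)}.
Proof.
move=> p q pF qF; rewrite /shift.
case: ifP => [/andP[_ pN]|_]; case: ifP => [/andP[_ qN]|_] //.
- exact: (can_inj (swapK i j)).
- by move=> pq; rewrite pq qF in pN.
- by move=> pq; rewrite -pq pF in qN.
Qed.

Lemma shift_signed_intersecting k i j F : i != j ->
  signed_intersecting k F -> signed_intersecting k (shift i j F @: F).
Proof.
move=> ij [Fk Fint]; split=> [_ /imsetP[p pF ->]|_ _ /imsetP[p pF ->] /imsetP[q qF ->]].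
  by rewrite /shift; case: ifP => _; rewrite ?signed_swap Fk.
(* One vector moves and the other stays. If the latter stays because its image is present, swapping
   both reduces to a pair in [F]; otherwise [conflict_swapl] applies. *)
have mixed p1 q1 : p1 \in F -> q1 \in F -> coord p1 i < coord p1 j ->
    (coord q1 i < coord q1 j) && (swap i j q1 \notin F) = false ->
    ~~ conflict (swap i j p1) q1.
  move=> pF1 qF1 lt1; have [lt2 /= /negbFE sF|le2 _] := ltnP (coord q1 i) (coord q1 j).
    by rewrite -(conflict_swap i j) swapK Fint.
  apply: contra (Fint _ _ pF1 qF1); apply: conflict_swapl => //.
  by have /andP[] := Fk _ qF1.
rewrite /shift; case: ifP => [/andP[ltp pN]|pE]; case: ifP => [/andP[ltq qN]|qE].
- by rewrite conflict_swap Fint.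
- exact: mixed.
- by rewrite conflict_sym mixed.
- exact: Fint.
Qed.

End Swap.

(** An effective shift moves larger entries to smaller positions, so it strictly lowers the sum of
    all entries weighted by their positions; repeated shifting must stop. *)
Lemma shifted_family (n k : nat) (F : {set {set 'I_n} * 'I_n}) :
  signed_intersecting k F -> exists F', [/\ signed_intersecting k F', #|F'| = #|F| &
    forall p (i j : 'I_n), p \in F' -> i < j -> coord p i < coord p j -> swap i j p \in F'].
Proof.
move=> Ffam.
pose weight (p : {set 'I_n} * 'I_n) := \sum_x coord p x * x.
pose potential (X : {set {set 'I_n} * 'I_n}) := \sum_(p in X) weight p.
have weight_swap p (i j : 'I_n) : i < j -> coord p i < coord p j ->
    weight (swap i j p) < weight p.
  move=> ij lt_ij; have ji : j != i by rewrite -val_eqE /= gtn_eqF.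
  rewrite /weight (bigD1 i) //= (bigD1 j) //=.
  rewrite [X in _ < X](bigD1 i) //= [X in _ < _ + X](bigD1 j) //=.
  rewrite !coord_swap tpermL tpermR.
  set S1 := \sum_(_ | _) _; set S2 := \sum_(_ | _) _.
  have -> : S1 = S2.
    by apply: eq_bigr => x /andP[xi xj]; rewrite coord_swap tpermD // eq_sym.
  by rewrite !addnA ltn_add2r; move: (coord p i) (coord p j) (val i) (val j) ij lt_ij; nia.
have [m] : exists m, potential F < m by exists (potential F).+1.
elim: m F Ffam => [|m IHm] F Ffam Fm //.
have [stable|] := boolP [forall p in F, forall i : 'I_n, forall j : 'I_n,
    (i < j) ==> (coord p i < coord p j) ==> (swap i j p \in F)].
  exists F; split=> // p i j pF ij lt_ij.
  have /forallP/(_ i)/forallP/(_ j) := forall_inP stable p pF.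
  by rewrite ij lt_ij.
case/forall_inPn=> p pF /forallPn[i /forallPn[j]].
rewrite !negb_imply => /and3P[ij lt_ij spN].
have ijD : i != j by rewrite -val_eqE /= ltn_eqF.
have lt_pot : potential (shift i j F @: F) < potential F.
  rewrite /potential big_imset /=; last exact: shift_inj.
  rewrite (bigD1 p) //= [X in _ < X](bigD1 p) //= -addSn leq_add //.
    by rewrite /shift lt_ij spN; apply: weight_swap.
  apply: leq_sum => q _; rewrite /shift.
  by case: ifP => // /andP[lt_q _]; apply/ltnW/weight_swap.
have [F' [F'fam F'F F's]] := IHm _ (shift_signed_intersecting ijD Ffam) (leq_trans lt_pot Fm).
by exists F'; split=> //; rewrite F'F card_in_imset //; exact: shift_inj.
Qed.

(** * Induction on the dimension *)

(** Vectors over [A] and over its complement always conflict: each -1 lies outside its own set,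
    hence in the other one. So each complementary pair carries at most [k] vectors; summing over all
    [A] counts [F] twice, and the central binomial coefficient is halved too. *)
Lemma signed_intersecting_half (T : finType) (k : nat) (F : {set {set T} * T}) :
  0 < k -> #|T| = 2 * k -> signed_intersecting k F -> #|F| <= k * 'C(#|T|.-1, k).
Proof.
move=> k0 Tk [Fk Fint].
pose t (A : {set T}) := #|[set a | (A, a) \in F]|.
have Ft : #|F| = \sum_(A : {set T} | #|A| == k) t A.
  rewrite -sum1_card (eq_bigl (fun p : {set T} * T => (#|p.1| == k) && ((p.1, p.2) \in F))).
    rewrite -(pair_big_dep (fun A : {set T} => #|A| == k)
      (fun A a => (A, a) \in F) (fun _ _ => 1)).
    by apply: eq_bigr => A _; rewrite sum1dep_card.
  by case=> A a /=; apply/idP/andP => [AF|[]] //; have /andP[] := Fk _ AF.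
have FtC : #|F| = \sum_(A : {set T} | #|A| == k) t (~: A).
  rewrite Ft (reindex_inj (@setC_inj T)); apply: eq_bigl => A /=.
  by have := cardsC A; rewrite Tk; lia.
have tk (A : {set T}) : #|A| == k -> t A + t (~: A) <= k.
  move=> /eqP Ak; have AC : #|~: A| = k by have := cardsC A; rewrite Tk; lia.
  have tA (B : {set T}) : t B <= #|~: B|.
    apply/subset_leq_card/subsetP => a; rewrite !inE => BF.
    by have /andP[] := Fk _ BF.
  have [->|] := posnP (t A); first by rewrite add0n (leq_trans (tA _)) ?setCK ?Ak.
  have [->|] := posnP (t (~: A)); first by rewrite addn0 (leq_trans (tA _)) ?AC.
  move=> /card_gt0P[b + ] /card_gt0P[a]; rewrite !inE => bF aF.
  have /negP[] := Fint _ _ aF bF; rewrite /conflict /= -setI_eq0 setICr eqxx inE /=.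
  by have /andP[_ /=] := Fk _ aF; have /andP[_ /=] := Fk _ bF; rewrite !inE negbK => -> ->.
have : #|F| + #|F| <= k * 'C(#|T|, k).
  rewrite {1}Ft FtC -big_split /=; apply: (@leq_trans (\sum_(A : {set T} | #|A| == k) k)).
    by apply: leq_sum => A; exact: tk.
  by rewrite sum_nat_const -card_draws cardsE mulnC.
have -> : 'C(#|T|, k) = 2 * 'C(#|T|.-1, k).
  have := mul_bin_down #|T| k; rewrite {1 3}Tk (_ : 2 * k - k = k); last by lia.
  by rewrite (mulnC 2) -mulnA => /eqP; rewrite eqn_pmul2l // => /eqP.
lia.
Qed.

(** * Splitting a shifted family by its last coordinate *)

Section Step.
Variables (k n : nat) (F : {set {set 'I_n.+2} * 'I_n.+2}).
Hypothesis Ffam : signed_intersecting k F.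
Hypothesis Fstable : forall p (i j : 'I_n.+2),
  p \in F -> i < j -> coord p i < coord p j -> swap i j p \in F.

Implicit Types (A : {set 'I_n.+1}) (p q : {set 'I_n.+1} * 'I_n.+1).

Let Fk := proj1 Ffam.
Let Fint := proj2 Ffam.

Let L : 'I_n.+1 -> 'I_n.+2 := lift ord_max.
Let top : 'I_n.+2 := ord_max.

Let L_inj : injective L := @lift_inj _ ord_max.
Let L_neq x : (L x == top) = false.
Proof. by rewrite eq_sym; apply/negbTE/neq_lift. Qed.
Let top_notin A : (top \in L @: A) = false.
Proof. by apply/imsetP => -[x _ /eqP]; rewrite eq_sym L_neq. Qed.
Let mem_L A x : (L x \in L @: A) = (x \in A).
Proof. exact: mem_imset. Qed.
Let ltL x y : (L x < L y) = (x < y).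
Proof. by rewrite !lift_max. Qed.
Let lt_top x : L x < top.
Proof. by rewrite lift_max. Qed.
Let topP x : x = top \/ exists y, x = L y.
Proof. by case: (unliftP top x) => [y ->|->]; [right; exists y | left]. Qed.
Let preimL (A : {set 'I_n.+2}) : A :\ top = L @: (L @^-1: A).
Proof.
apply/setP => x; have [->|[y ->]] := topP x; first by rewrite top_notin !inE eqxx.
by rewrite mem_L !inE L_neq.
Qed.

Definition below := [set p : {set 'I_n.+1} * 'I_n.+1 | (L @: p.1, L p.2) \in F].
Definition minus_top := [set A : {set 'I_n.+1} | (L @: A, top) \in F].
(** Keeping [e] in [U] in place of [top] makes [U] a [k]-set of the smaller ground set, comparable
    with the members of [minus_top]. These two families are the [K] and [G] of the counting part. *)
Definition plus_top :=
  [set p : {set 'I_n.+1} * 'I_n.+1 |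
    (p.2 \in p.1) && ((top |: L @: (p.1 :\ p.2), L p.2) \in F)].

(** The three families, embedded back, cover [F] according to the entry 0, -1 or +1 at [top]. *)
Lemma card_top_split : #|F| <= #|below| + (#|minus_top| + #|plus_top|).
Proof.
pose f0 (p : {set 'I_n.+1} * 'I_n.+1) := (L @: p.1, L p.2).
pose f1 (A : {set 'I_n.+1}) := (L @: A, top).
pose f2 (p : {set 'I_n.+1} * 'I_n.+1) := (top |: L @: (p.1 :\ p.2), L p.2).
apply: (@leq_trans #|(f0 @: below) :|: ((f1 @: minus_top) :|: (f2 @: plus_top))|); last first.
  do 2![apply: (leq_trans (leq_card_setU _ _)); apply: leq_add; first exact: leq_imset_card].
  exact: leq_imset_card.
apply/subset_leq_card/subsetP => -[A a] pF; rewrite !inE.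
have /andP[/= _ aA] := Fk pF.
case: (topP a) pF aA => [->|[b ->]] pF aA.
  have AE : A = L @: (L @^-1: A).
    by rewrite -preimL; apply/setP => x; rewrite !inE; case: eqP => // ->; rewrite (negbTE aA).
  apply/or3P/Or32/imsetP; exists (L @^-1: A); rewrite ?inE /f1 -AE //.
have [tA|tA] := boolP (top \in A).
  have bA : b \notin L @^-1: A by rewrite inE.
  have AE : A = top |: L @: ((b |: L @^-1: A) :\ b).
    by rewrite setU1K // -preimL setD1K.
  apply/or3P/Or33/imsetP; exists (b |: L @^-1: A, b).
    by rewrite inE /= setU11 -AE.
  by rewrite /f2 /= -AE.
have AE : A = L @: (L @^-1: A).
  by rewrite -preimL; apply/setP => x; rewrite !inE; case: eqP => // ->; rewrite (negbTE tA).
by apply/or3P/Or31/imsetP; exists (L @^-1: A, b); rewrite ?inE /f0 /= -AE.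
Qed.

Lemma below_signed_intersecting : signed_intersecting k below.
Proof.
split=> [p|p q]; rewrite !inE.
  by move=> /Fk; rewrite /signed /= mem_L card_imset.
move=> pF qF; apply: contra (Fint pF qF).
rewrite /conflict /= !mem_L -!setI_eq0 -imsetI ?imset_eq0 //.
by move=> x y _ _; exact: L_inj.
Qed.

Lemma minus_top_card A : A \in minus_top -> #|A| = k.
Proof. by rewrite inE => /Fk/andP[/eqP]; rewrite card_imset. Qed.

(** Shifting exchanges the -1 at [e] with the +1 at [top]. *)
Lemma plus_top_minus p : p \in plus_top -> p.1 \in minus_top.
Proof.
case: p => U e; rewrite !inE /= => /andP[eU pF].
have := Fstable pF (lt_top e).
rewrite /coord /= eqxx eq_sym L_neq setU11 => /(_ isT).
rewrite /swap /= tpermL; congr ((_, _) \in F); apply/setP => x.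
rewrite mem_tperm_imset; have [->|[y ->]] := topP x.
  by rewrite tpermR top_notin !inE L_neq mem_L !inE eqxx.
have [->|ye] := eqVneq y e; first by rewrite tpermL setU11 mem_L eU.
rewrite tpermD ?(inj_eq L_inj) 1?eq_sym ?L_neq //.
by rewrite !inE L_neq !mem_L !inE ye.
Qed.

(** Removing the only common point [e] from [U] leaves disjoint supports, while [e] lies in [A] and
    [top] in the other support: a conflict. *)
Lemma plus_minus_cross p A :
  p \in plus_top -> A \in minus_top -> p.1 :&: A != [set p.2].
Proof.
case: p => U e; rewrite !inE /= => /andP[eU pF] AF; apply/eqP => UA.
have /negP[] := Fint pF AF; rewrite /conflict /= mem_L setU11 andbT.
have eA : e \in A by have := set11 e; rewrite -UA inE => /andP[].
rewrite eA andbT -setI_eq0; apply/eqP/setP => x; rewrite !inE.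
have [->|[y ->]] := topP x; first by rewrite !top_notin andbF.
rewrite L_neq !mem_L !inE /= -andbA; apply/negP => /and3P[ye yU yA].
by move: ye; rewrite -in_set1 -UA inE yU yA.
Qed.

(** If [a] exceeded the mark [e], shifting would replace [a] by [e] in [A], giving a member of
    [minus_top] that meets [U] exactly in [e]. *)
Lemma plus_minus_disjoint p A a : p \in plus_top -> A \in minus_top ->
  p.1 :&: A = set0 -> a \in A -> a < p.2.
Proof.
case: p => U e /= pP AM UA aA; rewrite ltnNge; apply/negP => ea.
have eU : e \in U by move: pP; rewrite inE => /andP[].
have disP x : x \in U -> x \in A -> False.
  by move=> xU xA; have := in_set0 x; rewrite -UA inE xU xA.
have lt_ea : L e < L a.
  by rewrite ltL ltn_neqAle ea andbT; apply/eqP => /val_inj ea';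
     apply: (disP e eU); rewrite ea'.
have AF : (L @: A, top) \in F by move: AM; rewrite inE.
have eA : e \notin A by apply/negP; exact: disP.
have := Fstable AF lt_ea; rewrite /coord /= !L_neq !mem_L aA (negbTE eA) => /(_ isT).
rewrite /swap /= tpermD ?L_neq // => sF.
have /negP[] : U :&: (tperm e a @: A) != [set e].
  apply: (plus_minus_cross pP); rewrite inE; move: sF; congr ((_, _) \in F).
  apply/setP => x; rewrite mem_tperm_imset; have [->|[y ->]] := topP x.
    by rewrite tpermD ?L_neq // !top_notin.
  by rewrite -(inj_tperm _ _ _ L_inj) !mem_L mem_tperm_imset.
apply/eqP/setP => x; rewrite !inE mem_tperm_imset.
case: tpermP => [->|->|/eqP/negbTE-> _]; first by rewrite eU aA eqxx.
  by rewrite (negbTE eA) andbF; apply/esym/eqP => ae; apply: (disP e eU); rewrite -ae.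
by apply/negP => /andP[]; exact: disP.
Qed.

(** Both sets also lie in [minus_top], so disjointness would make each mark smaller than the
    other. *)
Lemma plus_top_intersecting p q : p \in plus_top -> q \in plus_top ->
  p.1 :&: q.1 != set0.
Proof.
move=> pP qP; apply/eqP => pq.
have mark (r : {set 'I_n.+1} * 'I_n.+1) : r \in plus_top -> r.2 \in r.1.
  by rewrite inE => /andP[].
have := plus_minus_disjoint pP (plus_top_minus qP) pq (mark _ qP).
rewrite setIC in pq.
have := plus_minus_disjoint qP (plus_top_minus pP) pq (mark _ pP).
lia.
Qed.

End Step.

Lemma signed_intersecting_bound (k n : nat) (F : {set {set 'I_n} * 'I_n}) :
  2 <= k -> 2 * k <= n -> n <= k ^ 2 -> signed_intersecting k F -> #|F| <= k * 'C(n - 1, k).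
Proof.
move=> k2 kn; have [m nE] : exists m, n = 2 * k + m by exists (n - 2 * k); lia.
subst n; elim: m {kn} F => [|m IHm] F mk Ffam.
  have := signed_intersecting_half (ltnW k2) _ Ffam; rewrite card_ord subn1; apply.
  exact: addn0.
move: IHm F mk Ffam; rewrite addnS; case E: (2 * k + m) => [|N] IH F mk Ffam; first by lia.
have [F' [F'fam <- F's]] := shifted_family Ffam.
apply: leq_trans (card_top_split F'fam) _.
(* Pascal's rule separates the induction bound for [below] from the increment given by
   [counting_bound]. *)
have binE : 'C(N.+1, k) = 'C(N, k) + 'C(N, k - 1).
  by case: k k2 {E mk IH F Ffam F' F'fam F's} => // k' _; rewrite binS subn1.
rewrite subn1 binE mulnDr; apply: leq_add.
  by have := IH _ (ltnW mk) (below_signed_intersecting F'fam); rewrite subn1.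
apply: counting_bound => //; try lia.
- exact: (minus_top_card F'fam).
- exact: (plus_top_minus F's).
- by move=> p; rewrite inE => /andP[].
- exact: (plus_minus_cross F'fam).
- exact: (plus_top_intersecting F'fam F's).
Qed.

(** * Sign vectors *)

Import Order.TTheory GRing.Theory Num.Theory.

Definition star (T : finType) (k : nat) (x : T) : {set {set T} * T} :=
  [set p | signed k p && (x \in p.1)].

Lemma star_signed_intersecting (T : finType) k (x : T) : signed_intersecting k (star k x).
Proof.
split=> [p|p q]; rewrite inE => /andP[] // _ xp; rewrite inE => /andP[_ xq].
by rewrite /conflict; apply/nandP; left; apply/negP => /disjointFr/(_ xp); rewrite xq.
Qed.

(** Choose the other [k - 1] positive coordinates, then the negative one among the remaining
    [#|T| - k]; an absorption identity gives the stated form. *)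
Lemma card_star (T : finType) k (x : T) : 0 < k -> #|star k x| = k * 'C(#|T| - 1, k).
Proof.
move=> k0.
rewrite -sum1dep_card.
rewrite (eq_bigl (fun p : {set T} * T => ((#|p.1| == k) && (x \in p.1)) && (p.2 \notin p.1))).
  rewrite -(pair_big_dep (fun A : {set T} => (#|A| == k) && (x \in A))
    (fun A a => a \notin A) (fun _ _ => 1)) /=.
  rewrite (eq_bigr (fun=> #|T| - k)) => [|A /andP[/eqP <- _]]; last first.
    rewrite sum1dep_card -[#|T|](cardsC A) addKn; apply: eq_card => a.
    by rewrite !inE.
  have TE : #|T| = #|[set~ x]|.+1 by rewrite cardsC1 prednK //; apply/card_gt0P; exists x.
  rewrite sum_nat_const [X in X * _](_ : _ = 'C(#|T| - 1, k - 1)); last first.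
    have := card_draws T k; have := cards_draws [set~ x] k.
    rewrite TE subn1 /= => cN cT.
    have := cardsID [set A : {set T} | x \in A] [set A : {set T} | #|A| == k].
    rewrite cT (_ : _ :\: _ = [set A : {set T} | A \subset [set~ x] & #|A| == k]); last first.
      by apply/setP => A; rewrite !inE subsetC sub1set inE.
    rewrite cN -[in 'C(_.+1, k)](subnK k0) addn1 binS -addn1 subnK // addnC => /addnI <-.
    by apply: eq_card => A; rewrite !inE.
  rewrite TE subn1 /= -[in RHS](subnK k0) addn1.
  rewrite mulnC [RHS]mul_bin_left; congr (_ * _); lia.
by move=> p; rewrite /signed andbAC.
Qed.

Local Open Scope ring_scope.

(** * Translation between pairs and real vectors *)

Section Vectors.
Variables (R : realType) (n k : nat).
Implicit Types p q : {set 'I_n} * 'I_n.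

Definition vec_of p : 'rV[R]_n := \row_i ((i \in p.1)%:R - (i == p.2)%:R).

Lemma dot_vec_of p q : dot (vec_of p) (vec_of q) =
  #|p.1 :&: q.1|%:R - (q.2 \in p.1)%:R - (p.2 \in q.1)%:R + (p.2 == q.2)%:R.
Proof.
rewrite /dot (eq_bigr (fun i => (i \in p.1 :&: q.1)%:R - (i == q.2)%:R * (q.2 \in p.1)%:R
   - (i == p.2)%:R * (p.2 \in q.1)%:R + (i == p.2)%:R * (p.2 == q.2)%:R)).
  have pick (j : 'I_n) (c : R) : \sum_i (i == j)%:R * c = c.
    by rewrite (bigD1 j) //= eqxx mul1r big1 ?addr0 // => i /negbTE ->; rewrite mul0r.
  rewrite big_split /= !sumrB !pick; congr (_ - _ - _ + _).
  by rewrite -natr_sum -big_mkcond sum1_card.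
move=> i _; rewrite !mxE inE mulrBl !mulrBr.
have -> : (i == p.2)%:R * (i \in q.1)%:R = (i == p.2)%:R * (p.2 \in q.1)%:R :> R.
  by case: eqP => [->|]; rewrite // !mul0r.
have -> : (i \in p.1)%:R * (i == q.2)%:R = (i == q.2)%:R * (q.2 \in p.1)%:R :> R.
  by rewrite mulrC; case: eqP => [->|]; rewrite // !mul0r.
have -> : (i == p.2)%:R * (i == q.2)%:R = (i == p.2)%:R * (p.2 == q.2)%:R :> R.
  by case: eqP => [->|]; rewrite // !mul0r.
by rewrite -mulnb natrM; ring.
Qed.

(** The scalar product reaches -2 only if the supports are disjoint and both cross memberships hold;
    equal -1 positions are incompatible with either membership. *)
Lemma conflictE p q : signed k p -> signed k q ->
  (-2 < dot (vec_of p) (vec_of q)) = ~~ conflict p q.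
Proof.
move=> /andP[_ pp] /andP[_ qq]; rewrite dot_vec_of /conflict -setI_eq0 -cards_eq0.
have : ~~ ((p.2 == q.2) && (p.2 \in q.1)) by apply/negP => /andP[/eqP ->]; apply/negP.
have : ~~ ((p.2 == q.2) && (q.2 \in p.1)) by apply/negP => /andP[/eqP <-]; apply/negP.
case: (p.2 == q.2); case: (p.2 \in q.1); case: (q.2 \in p.1) => //= _ _;
  case: #|_| => [|m] /=; try (have : 0 <= m%:R :> R by []); rewrite ?mulrSr; 
  by [move=> *; lra | apply/negbTE; rewrite -leNgt; lra].
Qed.

Let signs_neq : ((-1 == 1 :> R) = false) * ((1 == -1 :> R) = false) *
  ((0 == -1 :> R) = false) * ((0 == 1 :> R) = false).
Proof. by split; [split; [split|]|]; apply/eqP => *; lra. Qed.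

Lemma vec_of_eq1 p i : signed k p -> (vec_of p 0 i == 1) = (i \in p.1).
Proof.
move=> /andP[_ pp]; rewrite mxE; case: (eqVneq i p.2) => [->|_]; last first.
  by case: (i \in p.1); rewrite subr0 ?eqxx // signs_neq.
by rewrite (negbTE pp) sub0r signs_neq.
Qed.

Lemma vec_of_eqN1 p i : signed k p -> (vec_of p 0 i == -1) = (i == p.2).
Proof.
move=> /andP[_ pp]; rewrite mxE; case: (eqVneq i p.2) => [->|_]; last first.
  by case: (i \in p.1); rewrite subr0 signs_neq.
by rewrite (negbTE pp) sub0r eqxx.
Qed.

Lemma vec_of_inj : {in signed k &, injective vec_of}.
Proof.
move=> p q ps qs pq.
have pq1 : p.1 = q.1 by apply/setP => i; rewrite -!vec_of_eq1 // pq.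
have pq2 : p.2 = q.2 by apply/eqP; rewrite -(vec_of_eqN1 _ qs) -pq vec_of_eqN1.
by rewrite (surjective_pairing p) pq1 pq2 -surjective_pairing.
Qed.

Lemma is_vec1_vec_of p : signed k p -> is_vec1 k (vec_of p).
Proof.
move=> ps; have /andP[/eqP pk pp] := ps; apply/and3P; split.
- apply/forallP => i; rewrite !inE vec_of_eq1 // vec_of_eqN1 // mxE.
  by case: (i \in p.1); case: (i == p.2); rewrite ?subrr ?subr0 ?eqxx ?orbT.
- by rewrite -pk; apply/eqP/eq_card => i; rewrite inE vec_of_eq1.
- by apply/cards1P; exists p.2; apply/setP => i; rewrite !inE vec_of_eqN1.
Qed.

Lemma vec1_vec_of (v : 'rV[R]_n) : is_vec1 k v -> exists2 p, signed k p & v = vec_of p.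
Proof.
move=> /and3P[/forallP vs vk /cards1P[a va]].
have vaE i : (v 0 i == -1) = (i == a) by rewrite -in_set1 -va inE.
exists ([set i | v 0 i == 1], a).
  rewrite /signed /= vk inE; have /eqP-> := etrans (vaE a) (eqxx a).
  by rewrite signs_neq.
apply/rowP => i; rewrite mxE inE /= -vaE; have := vs i; rewrite !inE.
by case/or3P => /eqP ->; rewrite ?eqxx !signs_neq ?subr0 ?sub0r.
Qed.

End Vectors.

Local Open Scope fset_scope.

Theorem theorem2 (R : realType) (n k : nat) :
  (2 <= k)%N -> (2 * k <= n)%N -> (n <= k ^ 2)%N ->
  max_intersecting R n k = (k * 'C(n - 1, k))%N.
Proof.
move=> k2 kn nk.
pose image (P : {set {set 'I_n} * 'I_n}) := [fset vec_of R p | p in P].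
have intersectingP (P : {set {set 'I_n} * 'I_n}) : (forall p, p \in P -> signed k p) ->
    intersecting (image P) -> signed_intersecting k P.
  move=> Ps /forallP Pint; split=> // p q pP qP.
  have mem r : r \in P -> vec_of R r \in image P by move=> rP; apply/imfsetP; exists r.
  have /forallP/(_ [` mem q qP]) := Pint [` mem p pP].
  by rewrite /= (@conflictE _ _ k) ?Ps.
have card_image (P : {set {set 'I_n} * 'I_n}) : (forall p, p \in P -> signed k p) ->
    #|` image P| = #|P|.
  move=> Ps; rewrite card_in_imfset /= -?cardE // => p q pP qP.
  by apply: (@vec_of_inj R n k); exact: Ps.
apply/eqP; rewrite eqn_leq; apply/andP; split.
  apply/bigmax_leqP_seq => F; rewrite fpowersetE => /fsubsetP Fvec Fint.
  (* Upper bound: pull [F] back to the pairs encoding its vectors. *)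
  pose P := [set p : {set 'I_n} * 'I_n | signed k p && (vec_of R p \in F)].
  have FE : F = image P.
    apply/fsetP => v; apply/idP/imfsetP => [vF|[p /= + ->]]; last by rewrite inE => /andP[].
    have := Fvec v vF; rewrite mem_vec1 => /vec1_vec_of[p ps vE].
    by exists p; rewrite //= inE ps -vE.
  have Ps p : p \in P -> signed k p by rewrite inE => /andP[].
  rewrite FE in Fint *; rewrite card_image //.
  exact/signed_intersecting_bound/intersectingP.
(* Lower bound: a successor dimension provides the coordinate [ord0] as the centre of the star. *)
case: n kn nk @image intersectingP card_image => [|n'] kn nk image _ card_image; first by lia.
have starE : #|` image (star k ord0)| = (k * 'C(n'.+1 - 1, k))%N.
  rewrite -[in RHS](card_ord n'.+1) -(card_star ord0 (ltnW k2)) card_image // => p.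
  by rewrite inE => /andP[].
rewrite -starE; apply: leq_bigmax_seq.
  rewrite fpowersetE; apply/fsubsetP => _ /imfsetP[p /= + ->].
  by rewrite inE mem_vec1 => /andP[ps _]; exact: is_vec1_vec_of.
apply/forallP => v; apply/forallP => w.
have /imfsetP[p /= pS ->] := valP v; have /imfsetP[q /= qS ->] := valP w.
have [sk sint] := star_signed_intersecting k (ord0 : 'I_n'.+1).
by rewrite (@conflictE _ _ k) ?sint ?sk.
Qed.
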